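(* Let $1\le p\le\infty$ and let $T=M_wEM_u$ be a bounded weighted conditional expectation operator on $L^p(\mathcal{F})$. Then $\alpha(T)\le 2$, and if $E(uw)$ is bounded away from zero, then $\delta(T)\le 2$.
   Context: $(X,\mathcal{F},\mu)$ is a complete $\sigma$-finite measure space and $\mathcal{A}\subseteq\mathcal{F}$ is a $\sigma$-subalgebra such that $(X,\mathcal{A},\mu|_{\mathcal{A}})$ is also $\sigma$-finite. Statements about sets and functions hold up to sets of measure zero. $L^0(\mathcal{F})$ is the set of (classes of) $\mathcal{F}$-measurable complex-valued functions, and $L^p(\mathcal{F})=L^p(X,\mathcal{F},\mu)$. $E=E^{\mathcal{A}}$ is the conditional expectation with respect to $\mathcal{A}$: $E(f)$ is the unique $\mathcal{A}$-measurable function with $\int_A E(f)\,d\mu=\int_A f\,d\mu$ for all $A\in\mathcal{A}$, defined for $f\ge 0$ and for $f\in L^p(\mathcal{F})$, and extended to conditionable functions (those with $E(|f|)<\infty$ a.e.). For $u,w\in L^0(\mathcal{F})$ such that $uf$ is conditionable and $wE(uf)\in L^p(\mathcal{F})$ for all $f\in L^p(\mathcal{F})$, the weighted conditional expectation operator $T=M_wEM_u$ on $L^p(\mathcal{F})$ is $Tf=wE(uf)$; it is assumed to be bounded (then $E(uw)$ is defined and lies in $L^\infty(\mathcal{A})$). $E(uw)$ is bounded away from zero if there exists $C>0$ with $\mu(\{x\in X:|E(uw)(x)|\le C\})=0$. $\mathcal{N}(\cdot)$ and $\mathcal{R}(\cdot)$ denote null space and range. The ascent $\alpha(T)$ (resp.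 descent $\delta(T)$) is the smallest non-negative integer $k$ with $\mathcal{N}(T^k)=\mathcal{N}(T^{k+1})$ (resp. $\mathcal{R}(T^k)=\mathcal{R}(T^{k+1})$), where $T^0=I$, and is $\infty$ if there is no such $k$. *)

(* Defs.v *)
From HB Require Import structures.
From mathcomp Require Import all_boot all_order all_algebra.
From mathcomp Require Import all_classical all_reals all_analysis.
From mathcomp Require Import measurable_realfun complex.

Set Implicit Arguments.
Unset Strict Implicit.
Unset Printing Implicit Defensive.

Import Order.TTheory GRing.Theory Num.Theory.
Import numFieldNormedType.Exports.

Local Open Scope classical_set_scope.
Local Open Scope ring_scope.

(* Elements of L^0 and L^p are represented by functions X -> R[i].  Classes modulo
   almost everywhere equality are not formed; instead null spaces and ranges are
   defined up to null sets, so that they are saturated for a.e. equality and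
   equalities between them are equalities of subspaces of L^p. *)

Section weighted_conditional_expectation.
Context {R : realType} {d : measure_display} {X : measurableType d}.
Variable mu : {measure set X -> \bar R}.

Definition modulus (f : X -> R[i]) (x : X) : R := ComplexField.Normc.normc (f x).

Definition mulop (u f : X -> R[i]) (x : X) : R[i] := u x * f x.

Definition L0 : set (X -> R[i]) :=
  [set f | measurable_fun setT (fun x => complex.Re (f x)) /\
           measurable_fun setT (fun x => complex.Im (f x))].

Definition Lp_norm (p : \bar R) (f : X -> R[i]) : \bar R :=
  'N[mu]_p[EFin \o modulus f]%E.

Definition Lp (p : \bar R) : set (X -> R[i]) :=
  [set f | L0 f /\ (Lp_norm p f < +oo)%E].

Definition bounded_operator (p : \bar R) (T : (X -> R[i]) -> X -> R[i]) :=
  exists M : R, forall f, Lp p f -> (Lp_norm p (T f) <= M%:E * Lp_norm p f)%E.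

Definition null_space (p : \bar R) (T : (X -> R[i]) -> X -> R[i]) :
    set (X -> R[i]) :=
  [set f | Lp p f /\ T f = cst 0 %[ae mu]].

Definition range_space (p : \bar R) (T : (X -> R[i]) -> X -> R[i]) :
    set (X -> R[i]) :=
  [set g | Lp p g /\ exists2 f, Lp p f & T f = g %[ae mu]].

(* Values in \bar R, so that +oo can stand for "no such index". *)
Definition least_index (P : nat -> Prop) : \bar R :=
  match pselect (exists k, `[< P k >]) with
  | left exP => (ex_minn exP)%:R%:E
  | right _ => +oo%E
  end.

Definition ascent (p : \bar R) (T : (X -> R[i]) -> X -> R[i]) : \bar R :=
  least_index (fun k =>
    null_space p (iter k T) = null_space p (iter k.+1 T)).

Definition descent (p : \bar R) (T : (X -> R[i]) -> X -> R[i]) : \bar R :=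
  least_index (fun k =>
    range_space p (iter k T) = range_space p (iter k.+1 T)).

Section conditional_expectation.
Variable A : set (set X).

(* When A is a sigma-algebra, the measurable sets of g_sigma_algebraType A are
   exactly the elements of A. *)
Definition is_condexp_ge0 (f g : X -> \bar R) :=
  [/\ forall x, (0 <= g x)%E,
      measurable_fun [set: g_sigma_algebraType A] g &
      forall B, A B -> (\int[mu]_(x in B) g x = \int[mu]_(x in B) f x)%E].

(* When mu is sigma-finite on A, a g with is_condexp_ge0 f g exists for every
   measurable f >= 0 and is unique up to a null set, so that the default value
   is never used. *)
Definition condexp_ge0 (f : X -> \bar R) : X -> \bar R :=
  xget (cst +oo%E) [set g | is_condexp_ge0 f g].

Definition conditionable (f : X -> R[i]) :=
  L0 f /\ {ae mu, forall x, (condexp_ge0 (EFin \o modulus f) x < +oo)%E}.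

(* fine only affects the null set where one of the terms is infinite, provided f
   is conditionable. *)
Definition condexp_real (f : X -> R) (x : X) : R :=
  fine (condexp_ge0 (EFin \o f^\+) x) - fine (condexp_ge0 (EFin \o f^\-) x).

Definition condexp (f : X -> R[i]) (x : X) : R[i] :=
  Complex (condexp_real (fun y => complex.Re (f y)) x)
          (condexp_real (fun y => complex.Im (f y)) x).

Definition wce (w u : X -> R[i]) : (X -> R[i]) -> X -> R[i] :=
  mulop w \o condexp \o mulop u.

End conditional_expectation.

Definition bounded_away_from_zero (f : X -> R[i]) :=
  exists2 C : R, 0 < C & mu [set x | modulus f x <= C] = 0%E.

End weighted_conditional_expectation.

(* Main.v *)
Require Import Defs.
From HB Require Import structures.
From mathcomp Require Import all_boot all_order all_algebra.
From mathcomp Require Import all_classical all_reals all_analysis.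
From mathcomp Require Import measurable_realfun ess_sup_inf complex ring lra.

Import Order.TTheory GRing.Theory Num.Theory.
Import numFieldNormedType.Exports.

Local Open Scope classical_set_scope.
Local Open Scope ring_scope.

(** The operator is [T f = w E(u f)], and everything rests on one identity:
    [T (T f) = E(u w) T f] almost everywhere ([wce_wce]).  Indeed
    [u T f = E(u f) (u w)], where [E(u f)] is measurable for the subalgebra and
    can be pulled out of the outer conditional expectation ([condexp_pull_out]).
    Writing [e = E(u w)], it follows that [T^2 f = e T f] and [T^3 f = e^2 T f],
    and [e^2 z = 0] exactly when [e z = 0], so [T^2] and [T^3] have the same null
    space ([null_space_iter2]).  If [|e| > C > 0] almost everywhere, then
    [h = f / e] belongs to [L^p], and [T h = (T f) / e] by the same pull-out, so
    that [T (T h) = T f]; hence [T] and [T^2] already have the same range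
    ([wce_wce_onto], [range_space_iter1]).

    The pull-out property needs [u w] to be conditionable ([conditionable_mulop]).
    This comes from testing the hypotheses on [f_n = conj u 1_{G_n}], where the
    sets [G_n] have finite measure, exhaust the space, and [u] is bounded on each
    of them.  As [u T f_n = E(u f_n) (u w)] is conditionable, [E|u w|] is finite
    wherever [E(u f_n) = E(|u|^2 1_{G_n})] is nonzero for some [n]; on the set
    where [E|u w|] is infinite all of these vanish, so [u] vanishes there, and so
    does [E|u w|], which makes that set null.

    Conditional expectations of nonnegative functions are handled through their
    integrals over the sets of the subalgebra.  They exist by the Radon-Nikodym
    theorem on pieces where the function is integrable ([exists_condexp_ge0]);
    comparing integrals gives uniqueness and monotonicity
    ([ae_le_of_integral_le]), additivity, and, by approximation with simple
    functions, the pull-out of nonnegative factors ([condexp_ge0M]).  Real and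
    complex functions are then reached through differences of nonnegative ones
    ([condexp_real_diff]). *)

(** * Measurability and modulus of complex-valued functions *)

Section complex_measurable.
Context {R : realType} {d : measure_display} {X : measurableType d}.
Implicit Types f g : X -> R[i].

Lemma modulus_ge0 f x : 0 <= modulus f x.
Proof. by rewrite /modulus; case: (f x) => a b /=; exact: sqrtr_ge0. Qed.

Lemma modulusM f g x : modulus (mulop f g) x = modulus f x * modulus g x.
Proof. exact: ComplexField.Normc.normcM. Qed.

Lemma modulus_eq0 f x : modulus f x = 0 -> f x = 0.
Proof. exact: ComplexField.Normc.eq0_normc. Qed.

Lemma le_Re_modulus f x : `|complex.Re (f x)| <= modulus f x.
Proof.
rewrite /modulus; case: (f x) => a b /=.
by rewrite -sqrtr_sqr ler_wsqrtr// lerDl sqr_ge0.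
Qed.

Lemma le_Im_modulus f x : `|complex.Im (f x)| <= modulus f x.
Proof.
rewrite /modulus; case: (f x) => a b /=.
by rewrite -sqrtr_sqr ler_wsqrtr// lerDr sqr_ge0.
Qed.

Lemma measurable_modulus f : L0 f -> measurable_fun [set: X] (modulus f).
Proof.
move=> [mRe mIm].
have -> : modulus f = @Num.sqrt R \o
    (fun x => complex.Re (f x) ^+ 2 + complex.Im (f x) ^+ 2).
  by apply/funext => x; rewrite /modulus /=; case: (f x).
apply: measurableT_comp.
  exact: continuous_measurable_fun (@sqrt_continuous R).
by apply: measurable_funD; exact: measurable_funX.
Qed.

Lemma L0_mulop f g : L0 f -> L0 g -> L0 (mulop f g).
Proof.
move=> [mRf mIf] [mRg mIg]; split.
- have -> : (fun x => complex.Re (mulop f g x)) = (fun x =>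
      complex.Re (f x) * complex.Re (g x) - complex.Im (f x) * complex.Im (g x)).
    by apply/funext => x; rewrite /mulop; case: (f x) (g x) => ? ? [].
  by apply: measurable_funB; exact: measurable_funM.
- have -> : (fun x => complex.Im (mulop f g x)) = (fun x =>
      complex.Re (f x) * complex.Im (g x) + complex.Im (f x) * complex.Re (g x)).
    by apply/funext => x; rewrite /mulop; case: (f x) (g x) => ? ? [].
  by apply: measurable_funD; exact: measurable_funM.
Qed.

Lemma L0_conj f : L0 f -> L0 (fun x => conjc (f x)).
Proof.
move=> [mRe mIm]; split.
  have -> // : (fun x => complex.Re (conjc (f x))) = (fun x => complex.Re (f x)).
  by apply/funext => x; case: (f x).
have -> : (fun x => complex.Im (conjc (f x))) = (fun x => - complex.Im (f x)).
  by apply/funext => x; case: (f x).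
exact: measurableT_comp.
Qed.

Lemma L0_real (f : X -> R) : measurable_fun [set: X] f ->
  L0 (fun x => Complex (f x) 0).
Proof. by move=> mf; split. Qed.

Lemma modulus_real (f : X -> R) x : 0 <= f x ->
  modulus (fun x => Complex (f x) 0) x = f x.
Proof. by move=> f0; rewrite /modulus/= expr0n/= addr0 sqrtr_sqr ger0_norm. Qed.

Lemma modulus_conj f x : modulus (fun x => conjc (f x)) x = modulus f x.
Proof. by rewrite /modulus; case: (f x) => a b /=; rewrite sqrrN. Qed.

Local Notation normc := ComplexField.Normc.normc.

(** A bounded function on all of the plane that agrees with the inverse outside
    the disc of radius [C]: the denominator [|z|^2] of [conj z / |z|^2] is
    replaced by [max C |z| ^ 2]. *)
Definition truncated_inv (C : R) (z : R[i]) : R[i] :=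
  Complex ((Num.max C (normc z) `^ (-1)) ^+ 2) 0 * conjc z.

Lemma L0_truncated_inv (C : R) f : L0 f -> L0 (fun x => truncated_inv C (f x)).
Proof.
move=> mf.
apply: (L0_mulop (fun x => Complex ((Num.max C (modulus f x) `^ (-1)) ^+ 2) 0)
  (fun x => conjc (f x))); last exact: L0_conj.
apply: L0_real; apply: measurable_funX.
apply: (measurableT_comp (measurable_powR (-1))).
by apply: measurable_maxr => //; exact: measurable_modulus.
Qed.

Lemma normc_truncated_inv (C : R) (z : R[i]) : 0 < C ->
  normc (truncated_inv C z) <= C^-1.
Proof.
move=> C0; rewrite /truncated_inv ComplexField.Normc.normcM.
set m := Num.max C _.
have Cm : C <= m by rewrite le_max lexx.
have m0 : 0 < m by exact: lt_le_trans Cm.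
have zm : normc z <= m by rewrite le_max lexx orbT.
have -> : normc (conjc z) = normc z by case: z {m Cm m0 zm} => a b /=; rewrite sqrrN.
rewrite /= expr0n/= addr0 sqrtr_sqr ger0_norm ?sqr_ge0//.
rewrite powR_inv1 ?(ltW m0)// expr2 -mulrA.
apply: (@le_trans _ _ (m^-1 * 1)).
  by rewrite ler_wpM2l ?invr_ge0 ?(ltW m0)// mulrC ler_pdivrMr// mul1r.
by rewrite mulr1 lef_pV2.
Qed.

Lemma truncated_invK (C : R) (z : R[i]) : 0 < C -> C <= normc z ->
  z * truncated_inv C z = 1.
Proof.
move=> C0 Cz; rewrite /truncated_inv (max_idPr Cz).
have z0 : 0 < normc z by exact: lt_le_trans Cz.
rewrite powR_inv1 ?(ltW z0)// mulrCA.
have -> : z * conjc z = Complex (normc z ^+ 2) 0.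
  case: z {Cz z0} => a b /=; rewrite sqr_sqrtr; last by rewrite addr_ge0 ?sqr_ge0.
  by apply/eqP; rewrite eq_complex/=; apply/andP; split; apply/eqP; ring.
apply/eqP; rewrite eq_complex/= !mulr0 mul0r subr0 addr0 -exprMn mulVf ?(gt_eqF z0)//.
by rewrite expr1n !eqxx.
Qed.

End complex_measurable.

(** * Membership in the Lebesgue spaces *)

Section Lp_domination.
Context {R : realType} {d : measure_display} {X : measurableType d}.
Variables (mu : {measure set X -> \bar R}) (p : \bar R).
Hypothesis p_ge1 : (1 <= p)%E.

Lemma Lp_dominated (K : R) (f g : X -> R[i]) : 0 <= K -> L0 g ->
  (forall x, modulus g x <= K * modulus f x) -> Lp mu p f -> Lp mu p g.
Proof.
move=> K0 mg gf [mf Nf]; split => //.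
have mmf := measurable_modulus _ mf; have mmg := measurable_modulus _ mg.
have abs_modulus (h : X -> R[i]) x : `|modulus h x| = modulus h x.
  by rewrite ger0_norm// modulus_ge0.
move: p_ge1 Nf; rewrite /Lp_norm unlock; case: p => [r||]; last by [].
- rewrite lee_fin => r1; have r0 : 0 < r by exact: lt_le_trans r1.
  move=> /lty_poweRy; rewrite invr_eq0 (gt_eqF r0) => /(_ isT) If.
  apply: poweR_lty; under eq_integral do rewrite /= abs_modulus.
  move: If; under eq_integral do rewrite /= abs_modulus.
  move=> If; apply: (@le_lt_trans _ _
      (\int[mu]_x ((K `^ r)%:E * (modulus f x `^ r)%:E))%E).
    apply: ge0_le_integral => //.
    - by move=> x _; rewrite lee_fin powR_ge0.
    - apply/measurable_EFinP.
      exact: (measurableT_comp (measurable_powR r)).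
    - apply: emeasurable_funM => //; apply/measurable_EFinP.
      exact: (measurableT_comp (measurable_powR r)).
    - move=> x _; rewrite lee_fin -powRM// ?modulus_ge0//.
      by rewrite ge0_ler_powR ?nnegrE ?modulus_ge0 ?mulr_ge0 ?modulus_ge0 ?(ltW r0).
  rewrite ge0_integralZl//.
  - by rewrite lte_mul_pinfty// lee_fin powR_ge0.
  - apply/measurable_EFinP.
    exact: (measurableT_comp (measurable_powR r)).
  - by move=> x _; rewrite lee_fin powR_ge0.
  - by rewrite lee_fin powR_ge0.
- move=> _; case: ifPn => // mu0 Nf.
  set N := ess_sup mu _ in Nf.
  apply: (@le_lt_trans _ _ (K%:E * N)%E); last by rewrite lte_mul_pinfty.
  apply/ess_supP; apply: filterS (ess_sup_ge mu (abse \o (EFin \o modulus f))).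
  move=> x fN; rewrite /= abs_modulus.
  apply: (@le_trans _ _ (K%:E * (modulus f x)%:E)%E); first by rewrite -EFinM lee_fin.
  by rewrite lee_wpmul2l//; move: fN; rewrite /= abs_modulus.
Qed.

Lemma Lp_indic (F : set X) : measurable F -> (mu F < +oo)%E ->
  Lp mu p (fun x => Complex (\1_F x) 0).
Proof.
move=> mF muF; split; first exact: L0_real.
have modF x : modulus (fun y => Complex (\1_F y : R) 0) x = \1_F x.
  exact: modulus_real.
move: p_ge1; rewrite /Lp_norm unlock; case: p => [r||]; last by [].
- rewrite lee_fin => r1; have r0 : 0 < r by exact: lt_le_trans r1.
  apply: poweR_lty.
  rewrite (eq_integral (EFin \o \1_F)); first by rewrite integral_indic// setIT.
  move=> x _; rewrite /= modF ger0_norm//; congr (_%:E).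
  by rewrite indicE; case: (x \in F); rewrite ?powR1// powR0// gt_eqF.
- move=> _; case: ifPn => // mu0; apply: (@le_lt_trans _ _ 1%E); last exact: ltry.
  apply/ess_supP; apply: nearW => x; rewrite /= modF ger0_norm// lee_fin.
  by rewrite indicE lern1 leq_b1.
Qed.
End Lp_domination.

(** * Radon-Nikodym derivatives on an image space *)

Section image_density.
Local Open Scope ereal_scope.
Context {R : realType} {d d' : measure_display}.
Context {X : measurableType d} {Y : measurableType d'}.
Variables (mu : {measure set X -> \bar R}) (phi : X -> Y) (f : X -> \bar R).
Hypothesis mphi : measurable_fun [set: X] phi.
Hypothesis f0 : forall x, 0 <= f x.
Hypothesis f_integrable : mu.-integrable [set: X] f.

(** The image under [phi] of the measure with density [f].  The proofs are
    arguments of the definition so that the measure structure is inferred from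
    the term alone. *)
Definition image_density of measurable_fun [set: X] phi & (forall x, 0 <= f x)
    & mu.-integrable [set: X] f : set Y -> \bar R :=
  fun B => \int[mu]_(x in phi @^-1` B) f x.

Local Notation nu := (image_density mphi f0 f_integrable).

Let measurable_preimage_phi B : measurable B -> measurable (phi @^-1` B).
Proof. by move=> mB; rewrite -[X in measurable X]setTI; exact: mphi. Qed.

Let nu0 : nu set0 = 0.
Proof. by rewrite /image_density preimage_set0 integral_set0. Qed.

Let nu_ge0 B : 0 <= nu B.
Proof. exact: integral_ge0. Qed.

Let nu_sigma_additive : semi_sigma_additive nu.
Proof.
move=> F mF tF mUF; rewrite /image_density preimage_bigcup ge0_integral_bigcup//.
- by apply: is_cvg_ereal_nneg_natsum_cond => i _ _; exact: nu_ge0.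
- by move=> i; exact: measurable_preimage_phi.
- apply: measurable_funTS; exact: measurable_int f_integrable.
- apply/trivIsetP => i j _ _ ij; rewrite -preimage_setI.
  by move/trivIsetP : tF => /(_ _ _ I I ij) ->; rewrite preimage_set0.
Qed.

HB.instance Definition _ :=
  isMeasure.Build _ _ _ nu nu0 nu_ge0 nu_sigma_additive.

Let nu_finite : fin_num_fun nu.
Proof.
move=> B mB; apply: integrable_fin_num.
  exact: measurable_preimage_phi.
apply: integrableS f_integrable => //; exact: measurable_preimage_phi.
Qed.

HB.instance Definition _ := Measure_isFinite.Build _ _ _ nu nu_finite.

End image_density.

(** The Radon-Nikodym theorem for a measure that carries its sigma-finiteness as a
    hypothesis instead of as a structure. *)
Lemma radon_nikodym_of_sigma_finite {R : realType} {d : measure_display}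
    {Y : measurableType d} (nu : {finite_measure set Y -> \bar R})
    (m : {measure set Y -> \bar R}) : sigma_finite [set: Y] m -> nu `<< m ->
  exists g : Y -> \bar R, [/\ forall x, (0 <= g x)%E, measurable_fun [set: Y] g &
    forall B, measurable B -> nu B = (\int[m]_(x in B) g x)%E].
Proof.
move=> m_sf num.
pose m' : {sigma_finite_measure set Y -> \bar R} :=
  HB.pack_for (sigma_finite_measure Y R) (Measure.sort m)
    (isSFinite.Build _ _ _ m (sfinite_measure_sigma_finite m_sf))
    (isSigmaFinite.Build _ _ _ m m_sf).
have num' : nu `<< m' by [].
exists (Radon_Nikodym_SigmaFinite.f nu m'); split.
- exact: Radon_Nikodym_SigmaFinite.f_ge0.
- exact: measurable_int (Radon_Nikodym_SigmaFinite.f_integrable num').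
- exact: Radon_Nikodym_SigmaFinite.f_integral.
Qed.

(** * Integrals over the sets of a subalgebra *)

Section subalgebra.
Context {R : realType} {d : measure_display} {X : measurableType d}.
Variables (mu : {measure set X -> \bar R}) (A : set (set X)).
Hypothesis A_sigma_algebra : sigma_algebra [set: X] A.
Hypothesis A_sub : A `<=` measurable.
Hypothesis muA_sigma_finite : sigma_finite [set: g_sigma_algebraType A] mu.
Local Notation XA := (g_sigma_algebraType A).

Lemma measurable_subalgebraE : (measurable : set (set XA)) = A.
Proof. exact: measurable_g_measurableTypeE. Qed.

Lemma subalgebra_measurableP (B : set X) : measurable (B : set XA) <-> A B.
Proof. by rewrite measurable_subalgebraE. Qed.

Lemma measurable_subalgebra (B : set X) : measurable (B : set XA) -> measurable B.
Proof. by rewrite measurable_subalgebraE; exact: A_sub. Qed.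

Lemma measurable_fun_subalgebra d' (Y : measurableType d') (g : X -> Y) :
  measurable_fun [set: XA] g -> measurable_fun [set: X] g.
Proof.
by move=> mg _ B mB; apply: measurable_subalgebra; apply: mg.
Qed.

Lemma L0_subalgebra (f : X -> R[i]) : L0 (f : XA -> R[i]) -> L0 f.
Proof. by move=> [mRe mIm]; split; exact: measurable_fun_subalgebra. Qed.

Lemma measurable_id_subalgebra : measurable_fun [set: X] (id : X -> XA).
Proof. by move=> _ B mB; rewrite setTI; exact: measurable_subalgebra. Qed.

Local Open Scope ereal_scope.

(** Otherwise [g2 < g1] on a set of the subalgebra of positive measure, which may
    be cut down so that [g2] is bounded on it and its measure is finite.  The
    integral of [g2] is then finite and subtraction shows that [g1 - g2 > 0] has
    integral [0]. *)
Lemma ae_le_of_integral_le (g1 g2 : X -> \bar R) :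
  (forall x, 0 <= g1 x) -> (forall x, 0 <= g2 x) ->
  measurable_fun [set: XA] g1 -> measurable_fun [set: XA] g2 ->
  (forall B, A B -> \int[mu]_(x in B) g1 x <= \int[mu]_(x in B) g2 x) ->
  {ae mu, forall x, g1 x <= g2 x}.
Proof.
move=> g10 g20 mg1 mg2 g12.
have [F FT Fm] := muA_sigma_finite.
pose B n k : set XA := (F n `&` [set x | g2 x <= k%:R%:E]) `&`
   ([set: XA] `&` [set x | g2 x < g1 x]).
have mB n k : A (B n k).
  rewrite -measurable_subalgebraE; apply: measurableI; last first.
    exact: measurable_lte.
  apply: measurableI; first exact: (Fm n).1.
  by rewrite -[X in measurable X]setTI; exact: emeasurable_fun_infty_c.
have B0 n k : mu.-negligible (B n k).
  have mBX : measurable (B n k : set X) by apply: A_sub.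
  have m1 : measurable_fun (B n k : set X) g1.
    by apply: measurable_funTS; exact: measurable_fun_subalgebra.
  have m2 : measurable_fun (B n k : set X) g2.
    by apply: measurable_funTS; exact: measurable_fun_subalgebra.
  have g2fin x : B n k x -> g2 x \is a fin_num.
    by move=> [[_ /= g2k] _]; rewrite ge0_fin_numE// (le_lt_trans g2k)// ltry.
  have mFX : measurable (F n : set X).
    by apply: measurable_subalgebra; exact: (Fm n).1.
  have I2 : \int[mu]_(x in B n k) g2 x < +oo.
    apply: (@le_lt_trans _ _ (\int[mu]_(x in B n k) (cst k%:R%:E) x)).
      by apply: ge0_le_integral => // x [[]].
    rewrite integral_cst// lte_mul_pinfty ?lee_fin//.
    apply: le_lt_trans (Fm n).2; apply: le_measure; rewrite ?inE//.
    by move=> x [[]].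
  have I0 : \int[mu]_(x in B n k) (g1 x - g2 x) = 0.
    have := g12 _ (mB n k).
    have -> : \int[mu]_(x in B n k) g1 x =
        \int[mu]_(x in B n k) (g2 x + (g1 x - g2 x)).
      apply: eq_integral => x /[!inE] Bx.
      by rewrite addeC subeK// g2fin.
    rewrite ge0_integralD//.
    - rewrite -{2}(adde0 (\int[mu]_(x in B n k) g2 x)) leeD2lE; last first.
        by rewrite ge0_fin_numE// integral_ge0.
      move=> le0; apply/eqP; rewrite eq_le le0/=.
      apply: integral_ge0 => x Bx; rewrite sube_ge0 ?g2fin ?orbT//.
      by case: Bx => _ [_ /ltW].
    - move=> x Bx; rewrite sube_ge0 ?g2fin ?orbT//.
      by case: Bx => _ [_ /ltW].
    - exact: emeasurable_funB.
  have : ae_eq mu (B n k) (g1 \- g2) (cst 0).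
    apply/ae_eq_integral_abs => //; first exact: emeasurable_funB.
    rewrite -[RHS]I0; apply: eq_integral => x /[!inE] Bx.
    rewrite gee0_abs// sube_ge0 ?g2fin ?orbT//.
    by case: Bx => _ [_ /ltW].
  apply: negligibleS => x Bx /(_ Bx)/=.
  have : 0 < g1 x - g2 x by rewrite sube_gt0; case: Bx => _ [].
  by move=> + g120; rewrite g120 ltxx.
have : mu.-negligible (\bigcup_n \bigcup_k (B n k : set X)).
  by apply: negligible_bigcup => n; apply: negligible_bigcup => k.
apply: negligibleS => x /= /negP; rewrite -ltNge => g21.
have : g2 x < +oo by rewrite (lt_le_trans g21)// leey.
have := g20 x; case g2x: (g2 x) => [r| |]// r0 _.
have : [set: XA] x by [].
rewrite FT => -[n _ Fx]; exists n => //; exists (Num.truncn r).+1 => //.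
split; split => //=; rewrite g2x lee_fin.
by rewrite ltW// truncnS_gt.
Qed.

(** The conditional expectation is the density of the image of [f mu] under the
    identity map onto the subalgebra, with respect to the image of [mu]. *)
Lemma exists_condexp_integrable (f : X -> \bar R) :
  (forall x, 0 <= f x) -> mu.-integrable [set: X] f ->
  exists g, is_condexp_ge0 mu A f g.
Proof.
move=> f0 f_int.
pose nu : {finite_measure set XA -> \bar R} :=
  image_density mu (id : X -> XA) f measurable_id_subalgebra f0 f_int.
have mid := measurable_id_subalgebra.
(* the image measure is a measure once the identity is known to be measurable *)
pose muA' : {measure set XA -> \bar R} := pushforward mu (id : X -> XA).
pose muA := muA' mid.
have num : nu `<< muA.
  apply/null_content_dominatesP => B mB muB0.
  apply: null_set_integral => //; first exact: measurable_subalgebra.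
  by apply: measurable_funTS; exact: measurable_int f_int.
have [g [g0 mg gE]] := radon_nikodym_of_sigma_finite nu muA muA_sigma_finite num.
exists g; split => // B; rewrite -measurable_subalgebraE => mB.
transitivity (nu B) => //; rewrite gE// /muA /muA'.
by rewrite (ge0_integral_pushforward mid)//; exact: measurable_funTS.
Qed.

Hypothesis mu_sigma_finite : sigma_finite [set: X] mu.

(** The space is cut into countably many pieces of finite measure on which [f] is
    bounded, and the conditional expectations of the pieces are added. *)
Lemma exists_condexp_ge0 (f : X -> R) : (forall x, 0 <= f x)%R ->
  measurable_fun [set: X] f -> exists g, is_condexp_ge0 mu A (EFin \o f) g.
Proof.
move=> f0 mf; have [F [FT F_nd Fm]] := (sigma_finiteP _ _).1 mu_sigma_finite.
have mEf : measurable_fun [set: X] (EFin \o f) by exact/measurable_EFinP.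
pose G n := F n `&` [set x | (EFin \o f) x <= n%:R%:E].
have mG n : measurable (G n).
  apply: measurableI; first exact: (Fm n).1.
  by rewrite -[X in measurable X]setTI; exact: emeasurable_fun_infty_c.
pose D := seqDU G.
have mD n : measurable (D n).
  by apply: measurableD => //; apply: bigsetU_measurable => i _.
have GT : \bigcup_n D n = [set: X].
  rewrite -seqDU_bigcup_eq -subTset => x _.
  have [n _ Fx] : (\bigcup_i F i) x by rewrite -FT.
  exists (maxn n (Num.truncn (f x)).+1) => //; split.
    by move: Fx; apply/subsetPset/F_nd; exact: leq_maxl.
  by rewrite /= lee_fin ltW// (lt_le_trans (truncnS_gt _))// ler_nat leq_maxr.
have gex n : exists g, is_condexp_ge0 mu A ((EFin \o f) \_ (D n)) g.
  apply: exists_condexp_integrable.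
    by move=> x; apply: erestrict_ge0 => y _; rewrite lee_fin.
  apply/(integrable_mkcond _ _).1 => //; apply/integrableP; split.
    exact: measurable_funTS.
  apply: (@le_lt_trans _ _ (\int[mu]_(x in D n) (cst n%:R%:E) x)).
    apply: ge0_le_integral => //.
    - by apply: measurableT_comp => //; exact: measurable_funTS.
    - move=> x Dx; rewrite /= ger0_norm//.
      by have [] : G n x by exact: subset_seqDU Dx.
  rewrite integral_cst// lte_mul_pinfty ?lee_fin//.
  apply: le_lt_trans (Fm n).2; apply: le_measure; rewrite ?inE//.
    exact: (Fm n).1.
  by apply: subset_trans (@subset_seqDU _ G n) _ => x [].
have [g gP] := boolp.choice gex.
have g0 n x : 0 <= g n x by have [] := gP n.
have mg n : measurable_fun [set: XA] (g n) by have [] := gP n.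
exists (fun x => \sum_(n <oo) g n x); split.
- by move=> x; exact: nneseries_ge0.
- exact: ge0_emeasurable_sum.
move=> B AB; have mB := A_sub _ AB.
rewrite integral_nneseries//; last first.
  by move=> n; apply: measurable_funTS; exact: measurable_fun_subalgebra.
rewrite -[in RHS](setIT B) -GT setI_bigcupr ge0_integral_bigcup//.
- apply: eq_eseriesr => n _; have [_ _ ->//] := gP n.
  by rewrite -integral_mkcondr.
- by move=> n; exact: measurableI.
- exact: measurable_funTS.
- by move=> x _; rewrite lee_fin.
- apply: trivIset_setIl; exact: trivIset_seqDU.
Qed.

Lemma condexp_ge0P (f : X -> R) : (forall x, 0 <= f x)%R ->
  measurable_fun [set: X] f ->
  is_condexp_ge0 mu A (EFin \o f) (condexp_ge0 mu A (EFin \o f)).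
Proof. by move=> f0 mf; have /xgetPex := exists_condexp_ge0 f f0 mf; exact. Qed.

Lemma is_condexp_ge0_le (f f' g g' : X -> \bar R) :
  (forall x, 0 <= f x) -> (forall x, f x <= f' x) ->
  measurable_fun [set: X] f -> measurable_fun [set: X] f' ->
  is_condexp_ge0 mu A f g -> is_condexp_ge0 mu A f' g' ->
  {ae mu, forall x, g x <= g' x}.
Proof.
move=> f0 ff' mf mf' [g0 mg gE] [g'0 mg' g'E].
apply: ae_le_of_integral_le => // B AB; rewrite gE// g'E//.
have mB := A_sub _ AB.
by apply: ge0_le_integral => //; [exact: measurable_funTS..].
Qed.

Lemma is_condexp_ge0_unique (f g g' : X -> \bar R) :
  is_condexp_ge0 mu A f g -> is_condexp_ge0 mu A f g' ->
  {ae mu, forall x, g x = g' x}.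
Proof.
move=> [g0 mg gE] [g'0 mg' g'E].
have := ae_le_of_integral_le g g' g0 g'0 mg mg' _.
have := ae_le_of_integral_le g' g g'0 g0 mg' mg _.
move=> /(_ _)/wrap[B AB|+]; first by rewrite gE// g'E.
move=> + /(_ _)/wrap[B AB|]; first by rewrite gE// g'E.
by apply: filterS2 => x g'g gg'; apply/eqP; rewrite eq_le gg' g'g.
Qed.

Import HBNNSimple.

(** The right-hand side only involves integrals of [f] over sets of the
    subalgebra intersected with [B]. *)
Lemma integral_nnsfun_mul (h : {nnsfun XA >-> R}) (f : X -> \bar R) B :
  (forall x, 0 <= f x) -> measurable_fun [set: X] f -> measurable B ->
  \int[mu]_(x in B) ((h x)%:E * f x) =
  \sum_(y \in range h) y%:E * \int[mu]_(x in B `&` (h @^-1` [set y])) f x.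
Proof.
move=> f0 mf mB.
have mh y : measurable (h @^-1` [set y] : set X) by exact: measurable_subalgebra.
transitivity (\int[mu]_(x in B) (\sum_(y \in range h)
    (y * \1_(h @^-1` [set y]) x)%:E * f x)).
  apply: eq_integral => x xB.
  rewrite -ge0_mule_fsuml => [|y]; last exact: nnfun_muleindic_ge0.
  by congr (_ * _); rewrite fsumEFin// [in LHS](fimfunE h x).
rewrite ge0_integral_fsum//; last 2 first.
  - move=> y; apply: emeasurable_funM; last exact: measurable_funTS.
    by apply/measurable_EFinP; apply: measurable_funM.
  - by move=> m y Ey; rewrite mule_ge0// nnfun_muleindic_ge0.
apply: eq_fsbigr => r rhn.
under eq_integral do rewrite EFinM -muleA.
rewrite ge0_integralZl//.
- congr (_ * _); rewrite integral_mkcondr; apply: eq_integral => x _.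
  by rewrite patchE indicE; case: ifPn => _; rewrite ?mul1e ?mul0e.
- apply: emeasurable_funM; last exact: measurable_funTS.
  by apply/measurable_EFinP; exact: measurable_funTS.
- by move=> t Et; rewrite mule_ge0 ?lee_fin ?f0.
- by move: rhn; rewrite inE => -[t _ <-]; rewrite lee_fin.
Qed.

(** True for simple [phi] by [integral_nnsfun_mul], and in general by monotone
    convergence along an increasing sequence of simple functions. *)
Lemma eq_integral_mul_subalgebra (phi : X -> R) (f g : X -> \bar R) :
  (forall x, 0 <= phi x)%R -> measurable_fun [set: XA] phi ->
  (forall x, 0 <= f x) -> measurable_fun [set: X] f ->
  (forall x, 0 <= g x) -> measurable_fun [set: X] g ->
  (forall B, A B -> \int[mu]_(x in B) f x = \int[mu]_(x in B) g x) ->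
  forall B, A B ->
    \int[mu]_(x in B) ((phi x)%:E * f x) = \int[mu]_(x in B) ((phi x)%:E * g x).
Proof.
move=> phi0 mphi f0 mf g0 mg fg B AB; have mB := A_sub _ AB.
have mEphi : measurable_fun [set: XA] (EFin \o phi) by exact/measurable_EFinP.
pose h := nnsfun_approx measurableT mEphi.
have cvg_h x : (h n x)%:E @[n --> \oo] --> (phi x)%:E.
  by apply: (cvg_nnsfun_approx measurableT mEphi) => // y _; rewrite lee_fin.
have nd_h x : {homo (fun n => h n x) : m n / (m <= n)%N >-> (m <= n)%R}.
  by move=> m n mn; exact/lefP/nd_nnsfun_approx.
have le_h n x : (h n x <= phi x)%R.
  have := cvg_lim (@ereal_hausdorff R) (cvg_h x); rewrite -lee_fin => <-.
  have ndE : {homo (fun n => (h n x)%:E) : m n / (m <= n)%N >-> m <= n}.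
    by move=> m k mk; rewrite lee_fin nd_h.
  rewrite (cvg_lim (@ereal_hausdorff R) (ereal_nondecreasing_cvgn ndE)).
  by apply: ereal_sup_ubound; exists n.
have mh n : measurable_fun [set: X] (h n).
  apply: measurable_fun_subalgebra; exact: measurable_funP.
have lim_h (F : X -> \bar R) : (forall x, 0 <= F x) ->
    measurable_fun [set: X] F -> \int[mu]_(x in B) ((phi x)%:E * F x) =
    limn (fun n => \int[mu]_(x in B) ((h n x)%:E * F x)).
  move=> F0 mF.
  rewrite -monotone_convergence//.
  - apply: eq_integral => x _; apply/esym/cvg_lim => //.
    (* [F x] may be infinite where [phi] vanishes, but [h n] vanishes there too *)
    have [phi_eq0|phi_neq0] := eqVneq (phi x) 0%R.
      rewrite phi_eq0 mul0e; apply: cvg_near_cst; apply: nearW => n.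
      suff -> : h n x = 0%R by rewrite mul0e.
      by apply/eqP; rewrite eq_le fun_ge0 andbT -phi_eq0.
    apply: cvgeM => //; last exact: cvg_cst.
    have [Fx|Fx] := boolP (F x \is a fin_num); first exact: mule_def_fin.
    by apply: mule_def_neq0_infty => //; rewrite eqe.
  - move=> n; apply: measurable_funTS; apply: emeasurable_funM => //;
      exact/measurable_EFinP.
  - by move=> n x _; rewrite mule_ge0 ?lee_fin.
  - by move=> x _ m n mn; rewrite lee_wpmul2r// lee_fin nd_h.
rewrite (lim_h f)// (lim_h g)//; congr (limn _); apply/funext => n.
rewrite !integral_nnsfun_mul//; apply: eq_fsbigr => y _.
have /fg-> // : A (B `&` h n @^-1` [set y]).
apply/subalgebra_measurableP; apply: measurableI => //.
exact/subalgebra_measurableP.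
Qed.

(** * Conditional expectation of nonnegative functions *)

Local Notation Epos f := (condexp_ge0 mu A (EFin \o f%R)).

Lemma measurable_condexp_ge0 (f : X -> R) : (forall x, 0 <= f x)%R ->
  measurable_fun [set: X] f -> measurable_fun [set: XA] (Epos f).
Proof. by move=> f0 mf; have [] := condexp_ge0P f f0 mf. Qed.

Lemma condexp_ge0_ge0 (f : X -> R) x : (forall x, 0 <= f x)%R ->
  measurable_fun [set: X] f -> 0 <= Epos f x.
Proof. by move=> f0 mf; have [] := condexp_ge0P f f0 mf. Qed.

Lemma condexp_ge0_le (f g : X -> R) : (forall x, 0 <= f x)%R ->
  (forall x, f x <= g x)%R ->
  measurable_fun [set: X] f -> measurable_fun [set: X] g ->
  {ae mu, forall x, Epos f x <= Epos g x}.
Proof.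
move=> f0 fg mf mg; have g0 x := le_trans (f0 x) (fg x).
apply: (is_condexp_ge0_le (EFin \o f) (EFin \o g)).
- by move=> x; rewrite /= lee_fin.
- by move=> x; rewrite /= lee_fin.
- exact/measurable_EFinP.
- exact/measurable_EFinP.
- exact: condexp_ge0P.
- exact: condexp_ge0P.
Qed.

Lemma condexp_ge0_lty (f g : X -> R) : (forall x, 0 <= f x)%R ->
  (forall x, f x <= g x)%R ->
  measurable_fun [set: X] f -> measurable_fun [set: X] g ->
  {ae mu, forall x, Epos g x < +oo} -> {ae mu, forall x, Epos f x < +oo}.
Proof.
move=> f0 fg mf mg; apply: filterS2 (condexp_ge0_le f g f0 fg mf mg) => x.
exact: le_lt_trans.
Qed.

Lemma condexp_ge0D (f g : X -> R) : (forall x, 0 <= f x)%R ->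
  (forall x, 0 <= g x)%R ->
  measurable_fun [set: X] f -> measurable_fun [set: X] g ->
  {ae mu, forall x, Epos (f \+ g)%R x = Epos f x + Epos g x}.
Proof.
move=> f0 g0 mf mg.
have [Ef0 mEf Ef] := condexp_ge0P f f0 mf.
have [Eg0 mEg Eg] := condexp_ge0P g g0 mg.
apply: is_condexp_ge0_unique.
  apply: condexp_ge0P; last exact: measurable_funD.
  by move=> x; rewrite addr_ge0.
split; first by move=> x; rewrite adde_ge0.
  exact: emeasurable_funD.
move=> B AB; have mB := A_sub _ AB.
rewrite ge0_integralD//; last 2 first.
  by apply: measurable_funTS; exact: measurable_fun_subalgebra.
  by apply: measurable_funTS; exact: measurable_fun_subalgebra.
rewrite Ef// Eg// -ge0_integralD//.
- by move=> x _; rewrite /= lee_fin.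
- by apply: measurable_funTS; exact/measurable_EFinP.
- by move=> x _; rewrite /= lee_fin.
- by apply: measurable_funTS; exact/measurable_EFinP.
Qed.

Lemma fine_condexp_ge0D (f g : X -> R) : (forall x, 0 <= f x)%R ->
  (forall x, 0 <= g x)%R ->
  measurable_fun [set: X] f -> measurable_fun [set: X] g ->
  {ae mu, forall x, Epos f x < +oo} -> {ae mu, forall x, Epos g x < +oo} ->
  {ae mu, forall x, fine (Epos (f \+ g)%R x) = (fine (Epos f x) + fine (Epos g x))%R}.
Proof.
move=> f0 g0 mf mg; apply: filterS3 (condexp_ge0D f g f0 g0 mf mg) => x -> fx gx.
by rewrite fineD// ge0_fin_numE// condexp_ge0_ge0.
Qed.

Lemma condexp_ge0M (phi f : X -> R) : (forall x, 0 <= phi x)%R ->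
  (forall x, 0 <= f x)%R ->
  measurable_fun [set: XA] phi -> measurable_fun [set: X] f ->
  {ae mu, forall x, Epos (phi \* f)%R x = (phi x)%:E * Epos f x}.
Proof.
move=> phi0 f0 mphi mf.
have [Ef0 mEf Ef] := condexp_ge0P f f0 mf.
apply: is_condexp_ge0_unique.
  apply: condexp_ge0P; first by move=> x; rewrite mulr_ge0.
  by apply: measurable_funM => //; exact: measurable_fun_subalgebra.
split; first by move=> x; rewrite mule_ge0 ?lee_fin.
  by apply: emeasurable_funM => //; exact/measurable_EFinP.
move=> B AB.
rewrite (eq_integral_mul_subalgebra phi (Epos f) (EFin \o f))//.
- exact: measurable_fun_subalgebra.
- exact/measurable_EFinP.
Qed.

Local Close Scope ereal_scope.

(** * Conditional expectation of real and complex functions *)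

Definition real_conditionable (f : X -> R) :=
  [/\ measurable_fun [set: X] f, {ae mu, forall x, (Epos f^\+ x < +oo)%E} &
      {ae mu, forall x, (Epos f^\- x < +oo)%E}].

Lemma measurable_condexp_real f : measurable_fun [set: X] f ->
  measurable_fun [set: XA] (condexp_real mu A f).
Proof.
move=> mf; apply: measurable_funB; apply: measurableT_comp => //;
  apply: measurable_condexp_ge0 => //.
- exact: measurable_funrpos.
- exact: measurable_funrneg.
Qed.

(** Any decomposition [a - b] into nonnegative conditionable functions computes
    the conditional expectation, not only the one into positive and negative
    parts: [f^+ + b = f^- + a] with [f = a - b], and expectations of nonnegative
    functions add up.  Linearity and pull-out reduce to the choice of [a] and
    [b]. *)
Lemma condexp_real_diff (a b : X -> R) : (forall x, 0 <= a x) ->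
  (forall x, 0 <= b x) ->
  measurable_fun [set: X] a -> measurable_fun [set: X] b ->
  {ae mu, forall x, (Epos a x < +oo)%E} -> {ae mu, forall x, (Epos b x < +oo)%E} ->
  real_conditionable (a \- b) /\
  {ae mu, forall x, condexp_real mu A (a \- b) x = fine (Epos a x) - fine (Epos b x)}.
Proof.
move=> a0 b0 ma mb Ea Eb; set f := a \- b.
have mf : measurable_fun [set: X] f by exact: measurable_funB.
have mfp : measurable_fun [set: X] f^\+ by exact: measurable_funrpos.
have mfn : measurable_fun [set: X] f^\- by exact: measurable_funrneg.
have Efp : {ae mu, forall x, (Epos f^\+ x < +oo)%E}.
  apply: condexp_ge0_lty Ea => // x.
  by rewrite /funrpos ge_max a0 andbT /f/= gerBl.
have Efn : {ae mu, forall x, (Epos f^\- x < +oo)%E}.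
  apply: condexp_ge0_lty Eb => // x.
  by rewrite /funrneg ge_max b0 andbT /f/= opprB gerBl.
split; first by split.
have fab : (f^\+ \+ b = f^\- \+ a)%R.
  apply/funext => x; have : f^\+ x - f^\- x = a x - b x.
    exact: (congr1 (fun g => g x) (funrposBneg f)).
  by move=> fx /=; lra.
have Dl := fine_condexp_ge0D f^\+ b (funrpos_ge0 f) b0 mfp mb Efp Eb.
have := fine_condexp_ge0D f^\- a (funrneg_ge0 f) a0 mfn ma Efn Ea.
rewrite -fab; apply: filterS2 Dl => x ->.
rewrite /condexp_real; move: (fine _) (fine _) (fine _) (fine _) => s t s' t'.
by move=> st; lra.
Qed.

Lemma fine_condexp_ge0 (f : X -> R) x : (forall y, 0 <= f y) ->
  measurable_fun [set: X] f -> (Epos f x < +oo)%E ->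
  Epos f x = (fine (Epos f x))%:E.
Proof.
by move=> f0 mf fx; rewrite fineK// ge0_fin_numE// condexp_ge0_ge0.
Qed.

Lemma condexp_ge0_lin (phi psi f g : X -> R) :
  (forall x, 0 <= phi x) -> (forall x, 0 <= psi x) ->
  (forall x, 0 <= f x) -> (forall x, 0 <= g x) ->
  measurable_fun [set: XA] phi -> measurable_fun [set: XA] psi ->
  measurable_fun [set: X] f -> measurable_fun [set: X] g ->
  {ae mu, forall x, (Epos f x < +oo)%E} -> {ae mu, forall x, (Epos g x < +oo)%E} ->
  {ae mu, forall x, Epos (phi \* f \+ psi \* g) x =
    (phi x * fine (Epos f x) + psi x * fine (Epos g x))%:E}.
Proof.
move=> phi0 psi0 f0 g0 mphi mpsi mf mg Ef Eg.
have mphiX := measurable_fun_subalgebra _ _ _ mphi.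
have mpsiX := measurable_fun_subalgebra _ _ _ mpsi.
have Dfg : {ae mu, forall x, (Epos (phi \* f \+ psi \* g) x =
    Epos (phi \* f) x + Epos (psi \* g) x)%E}.
  by apply: condexp_ge0D => [x|x||]; rewrite ?mulr_ge0//; exact: measurable_funM.
have Mf := condexp_ge0M phi f phi0 f0 mphi mf.
have Mg := condexp_ge0M psi g psi0 g0 mpsi mg.
near=> x.
rewrite EFinD !EFinM.
rewrite -fine_condexp_ge0//; last by near: x.
rewrite -fine_condexp_ge0//; last by near: x.
have <- : Epos (phi \* f) x = ((phi x)%:E * Epos f x)%E by near: x.
have <- : Epos (psi \* g) x = ((psi x)%:E * Epos g x)%E by near: x.
by near: x.
Unshelve. all: by end_near. Qed.

Lemma funrposBnegE (f : X -> R) x : f x = f^\+ x - f^\- x.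
Proof. exact: (congr1 (fun g => g x) (esym (funrposBneg f))). Qed.

Lemma condexp_realM (phi f : X -> R) : measurable_fun [set: XA] phi ->
  real_conditionable f ->
  real_conditionable (phi \* f) /\
  {ae mu, forall x, condexp_real mu A (phi \* f) x = phi x * condexp_real mu A f x}.
Proof.
move=> mphi [mf Efp Efn].
have mfp : measurable_fun [set: X] f^\+ by exact: measurable_funrpos.
have mfn : measurable_fun [set: X] f^\- by exact: measurable_funrneg.
have mpp : measurable_fun [set: XA] phi^\+ by exact: measurable_funrpos.
have mpn : measurable_fun [set: XA] phi^\- by exact: measurable_funrneg.
have mppX := measurable_fun_subalgebra _ _ _ mpp.
have mpnX := measurable_fun_subalgebra _ _ _ mpn.
pose a := phi^\+ \* f^\+ \+ phi^\- \* f^\-.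
pose b := phi^\+ \* f^\- \+ phi^\- \* f^\+.
have ab : phi \* f = a \- b.
  apply/funext => x; rewrite /a /b/=.
  by rewrite [in LHS](funrposBnegE phi) [in LHS](funrposBnegE f); ring.
have Ea := condexp_ge0_lin _ _ _ _ (funrpos_ge0 phi) (funrneg_ge0 phi)
  (funrpos_ge0 f) (funrneg_ge0 f) mpp mpn mfp mfn Efp Efn.
have Eb := condexp_ge0_lin _ _ _ _ (funrpos_ge0 phi) (funrneg_ge0 phi)
  (funrneg_ge0 f) (funrpos_ge0 f) mpp mpn mfn mfp Efn Efp.
rewrite -/a in Ea; rewrite -/b in Eb.
have [||||||cab Eab] := condexp_real_diff a b.
- by move=> x; rewrite addr_ge0// mulr_ge0// ?funrpos_ge0 ?funrneg_ge0.
- by move=> x; rewrite addr_ge0// mulr_ge0// ?funrpos_ge0 ?funrneg_ge0.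
- by apply: measurable_funD; exact: measurable_funM.
- by apply: measurable_funD; exact: measurable_funM.
- by apply: filterS Ea => x ->; rewrite ltry.
- by apply: filterS Eb => x ->; rewrite ltry.
rewrite ab; split => //.
apply: filterS3 Ea Eb Eab => x Ea Eb ->; rewrite Ea Eb /= /condexp_real.
by rewrite [in RHS](funrposBnegE phi); ring.
Qed.

Lemma condexp_realB (f g : X -> R) :
  real_conditionable f -> real_conditionable g ->
  real_conditionable (f \- g) /\
  {ae mu, forall x, condexp_real mu A (f \- g) x =
    condexp_real mu A f x - condexp_real mu A g x}.
Proof.
move=> [mf Efp Efn] [mg Egp Egn].
have mfp : measurable_fun [set: X] f^\+ by exact: measurable_funrpos.
have mfn : measurable_fun [set: X] f^\- by exact: measurable_funrneg.
have mgp : measurable_fun [set: X] g^\+ by exact: measurable_funrpos.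
have mgn : measurable_fun [set: X] g^\- by exact: measurable_funrneg.
pose a := f^\+ \+ g^\-; pose b := f^\- \+ g^\+.
have fgab : f \- g = a \- b.
  apply/funext => x; rewrite /a /b/=.
  by rewrite [in LHS](funrposBnegE f) [in LHS](funrposBnegE g); ring.
have Da := condexp_ge0D _ _ (funrpos_ge0 f) (funrneg_ge0 g) mfp mgn.
have Db := condexp_ge0D _ _ (funrneg_ge0 f) (funrpos_ge0 g) mfn mgp.
have [||||||cab Eab] := condexp_real_diff a b.
- by move=> x; rewrite addr_ge0// ?funrpos_ge0 ?funrneg_ge0.
- by move=> x; rewrite addr_ge0// ?funrpos_ge0 ?funrneg_ge0.
- exact: measurable_funD.
- exact: measurable_funD.
- by apply: filterS3 Da Efp Egn => x -> *; rewrite lte_add_pinfty.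
- by apply: filterS3 Db Efn Egp => x -> *; rewrite lte_add_pinfty.
rewrite fgab; split => //.
have Ea := fine_condexp_ge0D _ _ (funrpos_ge0 f) (funrneg_ge0 g) mfp mgn Efp Egn.
have Eb := fine_condexp_ge0D _ _ (funrneg_ge0 f) (funrpos_ge0 g) mfn mgp Efn Egp.
apply: filterS3 Ea Eb Eab => x Ea Eb ->; rewrite Ea Eb.
by rewrite opprD addrACA /condexp_real opprB.
Qed.

Lemma condexp_realN (f : X -> R) x :
  condexp_real mu A (\- f) x = - condexp_real mu A f x.
Proof. by rewrite /condexp_real funrposN funrnegN opprB. Qed.

Lemma condexp_realD (f g : X -> R) :
  real_conditionable f -> real_conditionable g ->
  {ae mu, forall x, condexp_real mu A (f \+ g) x =
    condexp_real mu A f x + condexp_real mu A g x}.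
Proof.
move=> cf [mg Egp Egn].
have cNg : real_conditionable (\- g).
  by split; rewrite ?funrposN ?funrnegN//; exact: measurableT_comp.
have -> : f \+ g = f \- (\- g) by apply/funext => x /=; rewrite opprK.
apply: filterS (condexp_realB _ _ cf cNg).2 => x ->.
by rewrite condexp_realN opprK.
Qed.

Lemma conditionable_Re_Im (h : X -> R[i]) : conditionable mu A h ->
  real_conditionable (fun x => complex.Re (h x)) /\
  real_conditionable (fun x => complex.Im (h x)).
Proof.
move=> [mh Eh]; have mm := measurable_modulus _ mh; have [mRe mIm] := mh.
have le_modulus (f : X -> R) : (forall x, `|f x| <= modulus h x) ->
    measurable_fun [set: X] f -> real_conditionable f.
  move=> fh mf; split => //; apply: condexp_ge0_lty Eh => //.
  - by move=> x; rewrite (le_trans _ (fh x))// /funrpos ge_max ler_norm normr_ge0.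
  - exact: measurable_funrpos.
  - move=> x; rewrite (le_trans _ (fh x))// /funrneg ge_max normr_ge0 andbT.
    by rewrite -normrN ler_norm.
  - exact: measurable_funrneg.
split; apply: le_modulus => // x; [exact: le_Re_modulus|exact: le_Im_modulus].
Qed.

(** Multiplication of complex numbers consists of four real products, to each of
    which [condexp_realM] applies. *)
Lemma condexp_pull_out (phi h : X -> R[i]) : L0 (phi : XA -> R[i]) ->
  conditionable mu A h ->
  {ae mu, forall x, condexp mu A (mulop phi h) x = phi x * condexp mu A h x}.
Proof.
move=> [mRe mIm] /conditionable_Re_Im[cRe cIm].
set a := fun x => complex.Re (phi x) in mRe *.
set b := fun x => complex.Im (phi x) in mIm *.
set s := fun x => complex.Re (h x) in cRe *.
set t := fun x => complex.Im (h x) in cIm *.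
have [cas Eas] := condexp_realM a s mRe cRe.
have [cat Eat] := condexp_realM a t mRe cIm.
have [cbs Ebs] := condexp_realM b s mIm cRe.
have [cbt Ebt] := condexp_realM b t mIm cIm.
have [_ EB] := condexp_realB _ _ cas cbt.
have ED := condexp_realD _ _ cat cbs.
near=> x; rewrite /condexp.
have -> : (fun y => complex.Re (mulop phi h y)) = (a \* s \- b \* t).
  by apply/funext => y; rewrite /mulop /a /s /b /t /=; case: (phi y) (h y) => ? ? [].
have -> : (fun y => complex.Im (mulop phi h y)) = (a \* t \+ b \* s).
  by apply/funext => y; rewrite /mulop /a /s /b /t /=; case: (phi y) (h y) => ? ? [].
rewrite (near EB)// (near ED)// (near Eas)// (near Eat)// (near Ebs)// (near Ebt)//.
by rewrite -/s -/t /a /b; case: (phi x).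
Unshelve. all: by end_near. Qed.

(** Both sides say that the integral over [S] is [0]. *)
Lemma condexp_ge0_ae_eq0 (f : X -> R) (S : set X) : (forall x, 0 <= f x) ->
  measurable_fun [set: X] f -> A S ->
  ae_eq mu S (EFin \o f) (cst 0%E) <-> ae_eq mu S (Epos f) (cst 0%E).
Proof.
move=> f0 mf AS; have mS := A_sub _ AS; have [E0 mE EE] := condexp_ge0P f f0 mf.
have mEf : measurable_fun S (EFin \o f).
  by apply: measurable_funTS; exact/measurable_EFinP.
have mEE : measurable_fun S (Epos f).
  by apply: measurable_funTS; exact: measurable_fun_subalgebra.
have absf : (\int[mu]_(x in S) `|(EFin \o f) x| = \int[mu]_(x in S) (EFin \o f) x)%E.
  by apply: eq_integral => x _; rewrite gee0_abs// lee_fin.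
have absE : (\int[mu]_(x in S) `|Epos f x| = \int[mu]_(x in S) Epos f x)%E.
  by apply: eq_integral => x _; rewrite gee0_abs.
split=> H; apply/(ae_eq_integral_abs mu mS _) => //.
  by rewrite absE EE// -absf; exact/(ae_eq_integral_abs mu mS _).
by rewrite absf -EE// -absE; exact/(ae_eq_integral_abs mu mS _).
Qed.

Lemma L0_condexp (h : X -> R[i]) : L0 h -> L0 (condexp mu A h : XA -> R[i]).
Proof. by move=> [mRe mIm]; split; exact: measurable_condexp_real. Qed.

(** The functions [f n] below are bounded with support of finite measure, hence
    in [L^p] for every [p], and [u * f n = |u|^2 1_{G n}] is nonnegative.  The set
    [S] where the conditional expectation of [|u w|] is infinite is shown to be
    null: [u] vanishes almost everywhere on it. *)
Lemma conditionable_mulop (p : \bar R) (u w : X -> R[i]) : (1 <= p)%E ->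
  L0 u -> L0 w ->
  (forall f, Lp mu p f -> conditionable mu A (mulop u f)) ->
  (forall f, Lp mu p f -> Lp mu p (wce mu A w u f)) ->
  conditionable mu A (mulop u w).
Proof.
move=> p1 mu_ mw Huf HT; split; first exact: L0_mulop.
have [F [FT F_nd Fm]] := (sigma_finiteP _ _).1 mu_sigma_finite.
have mmu := measurable_modulus _ mu_.
pose G n := F n `&` [set x | ((EFin \o modulus u) x <= n%:R%:E)%E].
have mG n : measurable (G n).
  apply: measurableI; first exact: (Fm n).1.
  rewrite -[X in measurable X]setTI; apply: emeasurable_fun_infty_c => //.
  exact/measurable_EFinP.
have GT x : exists n, G n x.
  have [n _ Fx] : (\bigcup_i F i) x by rewrite -FT.
  exists (maxn n (Num.truncn (modulus u x)).+1); split.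
    by move: Fx; apply/subsetPset/F_nd; exact: leq_maxl.
  by rewrite /= lee_fin ltW// (lt_le_trans (truncnS_gt _))// ler_nat leq_maxr.
pose f n : X -> R[i] := mulop (fun x => Complex (\1_(G n) x) 0) (fun x => conjc (u x)).
have mindic n : measurable_fun [set: X] (\1_(G n) : X -> R) by [].
have Lf n : Lp mu p (f n).
  apply: (Lp_dominated _ _ p1 n%:R (fun x => Complex (\1_(G n) x) 0)) => //.
  - by apply: L0_mulop; [exact: L0_real|exact: L0_conj].
  - move=> x; rewrite modulusM modulus_conj modulus_real// indicE.
    have [/set_mem[_]|] := boolP (x \in G n); last by rewrite mul0r mulr0.
    by rewrite /= lee_fin mul1r mulr1.
  - apply: Lp_indic => //; apply: le_lt_trans (Fm n).2.
    by apply: le_measure; rewrite ?inE//; [exact: (Fm n).1|move=> x []].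
pose v n x : R := \1_(G n) x * modulus u x ^+ 2.
have v0 n x : 0 <= v n x by rewrite mulr_ge0 ?sqr_ge0.
have mv n : measurable_fun [set: X] (v n).
  by apply: measurable_funM => //; exact: measurable_funX.
have ufv n : mulop u (f n) = fun x => Complex (v n x) 0.
  apply/funext => x; rewrite /mulop /f /mulop /v /modulus.
  case: (u x) => a b /=; rewrite sqr_sqrtr ?addr_ge0 ?sqr_ge0//.
  by apply/eqP; rewrite eq_complex/=; apply/andP; split; apply/eqP; ring.
pose e := Epos (modulus (mulop u w)).
have muw0 x : 0 <= modulus (mulop u w) x by exact: modulus_ge0.
have mmuw : measurable_fun [set: X] (modulus (mulop u w)).
  by apply: measurable_modulus; exact: L0_mulop.
pose phi n := condexp mu A (mulop u (f n)).
have mphi n : L0 (phi n : XA -> R[i]).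
  by apply: L0_condexp; have [] := Huf _ (Lf n).
have e_finite n : {ae mu, forall x, phi n x != 0 -> (e x < +oo)%E}.
  have [_] := Huf _ (HT _ (Lf n)).
  have -> : modulus (mulop u (wce mu A w u (f n))) =
      modulus (phi n) \* modulus (mulop u w).
    by apply/funext => x; rewrite /= /wce/= !modulusM mulrA mulrC.
  have := condexp_ge0M (modulus (phi n)) (modulus (mulop u w))
    (modulus_ge0 _) muw0 (measurable_modulus _ (mphi n)) mmuw.
  apply: filterS2 => x -> Ex phi0.
  have phi_gt0 : 0 < modulus (phi n) x.
    by rewrite lt_neqAle modulus_ge0 andbT eq_sym;
      apply: contra phi0 => /eqP/modulus_eq0 ->.
  rewrite ltNge leye_eq; apply/negP => /eqP ey.
  by move: Ex; rewrite -/e ey gt0_muley ?lte_fin// ltxx.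
have phiE n : {ae mu, forall x, phi n x = 0 -> Epos (v n) x = 0%E}.
  have [_ Ev] : conditionable mu A (mulop u (f n)) by exact: Huf.
  have modE : modulus (mulop u (f n)) = v n.
    by apply/funext => x; rewrite ufv modulus_real.
  rewrite modE in Ev.
  have vn0 : (v n)^\- = cst 0.
    by apply/funext => x; apply/max_idPr; rewrite oppr_le0.
  have vp : (v n)^\+ = v n.
    by apply/funext => x; apply/max_idPl.
  have E0 : ae_eq mu setT (Epos (cst 0 : X -> R)) (cst 0%E).
    apply/condexp_ge0_ae_eq0 => //; first exact/subalgebra_measurableP.
    exact: aeW.
  apply: filterS2 Ev E0 => x Evx /(_ I) E0x /(congr1 (@complex.Re R)).
  rewrite /phi ufv /= /condexp_real vp vn0 E0x subr0 => Ev0.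
  by rewrite fine_condexp_ge0// Ev0.
pose S := [set x | e x = +oo%E].
have AS : A S.
  apply/subalgebra_measurableP; rewrite -[X in measurable X]setTI.
  have me := measurable_condexp_ge0 _ muw0 mmuw.
  by apply: (me measurableT [set +oo%E]); exact: emeasurable_set1.
have S_u n : ae_eq mu S (EFin \o v n) (cst 0%E).
  apply/condexp_ge0_ae_eq0 => //.
  apply: filterS2 (e_finite n) (phiE n) => x ex pe Sx.
  apply: pe; apply/eqP; apply: contraT => /ex.
  by rewrite Sx ltxx.
have : ae_eq mu S e (cst 0%E).
  apply/condexp_ge0_ae_eq0 => //.
  have : {ae mu, forall x n, S x -> v n x = 0}.
    by apply: ae_foralln => n; apply: filterS (S_u n) => x vx Sx; case: (vx Sx).
  apply: filterS => x vx Sx /=.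
  have [n Gx] := GT x.
  have := vx n Sx; rewrite /v indicE mem_set// mul1r => /eqP.
  by rewrite sqrf_eq0 modulusM => /eqP ->; rewrite mul0r.
apply: filterS => x ex; rewrite ltNge leye_eq; apply/negP => /eqP ey.
by have := ex ey; rewrite /e ey.
Qed.
End subalgebra.

(** * Null spaces and ranges of iterates *)

Lemma le_least_index {R : realType} (P : nat -> Prop) k : P k ->
  (@least_index R P <= k%:R%:E)%E.
Proof.
move=> Pk; rewrite /least_index; case: pselect => [exP|[]]; last first.
  by exists k; apply/asboolP.
by case: ex_minnP => m _ m_min; rewrite lee_fin ler_nat m_min//; apply/asboolP.
Qed.

Lemma mulopE {R : realType} {d} {X : measurableType d} (f g : X -> R[i]) x :
  mulop f g x = f x * g x.
Proof. by []. Qed.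

Section operator.
Context {R : realType} {d : measure_display} {X : measurableType d}.
Variables (mu : {measure set X -> \bar R}) (p : \bar R).
Variable T : (X -> R[i]) -> X -> R[i].
Hypothesis T_Lp : forall f, Lp mu p f -> Lp mu p (T f).

(** [T^2 f = e T f] and [T^3 f = e^2 T f] vanish at the same points. *)
Lemma null_space_iter2 (e : X -> R[i]) :
  (forall f, Lp mu p f -> {ae mu, forall x, T (T f) x = e x * T f x}) ->
  null_space mu p (iter 2 T) = null_space mu p (iter 3 T).
Proof.
move=> TT; apply/seteqP; split => f [Lf f0]; split => //.
- by apply: filterS2 (TT _ (T_Lp _ Lf)) f0 => x /= -> /[apply] ->; rewrite mulr0.
- apply: filterS3 (TT _ Lf) (TT _ (T_Lp _ Lf)) f0 => x /= -> -> /[apply].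
  move=> /eqP; rewrite !mulf_eq0 orbA orbb => /orP[]/eqP ->.
    by rewrite mul0r.
  by rewrite mulr0.
Qed.

Lemma range_space_iter1 :
  (forall f, Lp mu p f -> exists2 h, Lp mu p h & T (T h) = T f %[ae mu]) ->
  range_space mu p (iter 1 T) = range_space mu p (iter 2 T).
Proof.
move=> TT; apply/seteqP; split => g [Lg [f Lf fg]]; split => //.
  have [h Lh Th] := TT _ Lf; exists h => //.
  by apply: filterS2 Th fg => x /= Thx fgx _; rewrite Thx ?fgx.
by exists (T f); first exact: T_Lp.
Qed.
End operator.

(** * Weighted conditional expectation operators *)

Section wce.
Context {R : realType} {d : measure_display} {X : measurableType d}.
Variables (mu : {measure set X -> \bar R}) (A : set (set X)).
Hypothesis mu_sigma_finite : sigma_finite [set: X] mu.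
Hypothesis A_sigma_algebra : sigma_algebra [set: X] A.
Hypothesis A_sub : A `<=` measurable.
Hypothesis muA_sigma_finite : sigma_finite [set: g_sigma_algebraType A] mu.
Variables (p : \bar R) (u w : X -> R[i]).
Hypothesis p_ge1 : (1 <= p)%E.
Hypotheses (u_L0 : L0 u) (w_L0 : L0 w).
Hypothesis uf_conditionable : forall f, Lp mu p f -> conditionable mu A (mulop u f).
Hypothesis T_Lp : forall f, Lp mu p f -> Lp mu p (wce mu A w u f).

Local Notation T := (wce mu A w u).
Local Notation E := (condexp mu A).

Let uw_conditionable : conditionable mu A (mulop u w).
Proof. exact: (conditionable_mulop mu A _ _ _ _ p). Qed.

(** [u T f = E(u f) (u w)], and [E(u f)] is measurable for the subalgebra. *)
Lemma wce_wce f : Lp mu p f ->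
  {ae mu, forall x, T (T f) x = E (mulop u w) x * T f x}.
Proof.
move=> /uf_conditionable[mf _]; rewrite /wce /=.
have -> : mulop u (mulop w (E (mulop u f))) = mulop (E (mulop u f)) (mulop u w).
  by apply/funext => x; rewrite /mulop; ring.
have LE : L0 (E (mulop u f) : g_sigma_algebraType A -> R[i]) by exact: L0_condexp.
have := condexp_pull_out mu A A_sigma_algebra A_sub muA_sigma_finite
  mu_sigma_finite (E (mulop u f)) (mulop u w) LE uw_conditionable.
by apply: filterS => x Ex; rewrite !mulopE Ex [LHS]mulrA [LHS]mulrC.
Qed.

(** The preimage is [h = f / e] with [e = E(u w)]; the inverse is truncated so that
    [h] is bounded by [|f| / C] everywhere and not only almost everywhere. *)
Lemma wce_wce_onto : bounded_away_from_zero mu (E (mulop u w)) ->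
  forall f, Lp mu p f -> exists2 h, Lp mu p h & T (T h) = T f %[ae mu].
Proof.
move=> [C C0 e_gtC] f Lf; set e := E (mulop u w).
have Le : L0 (e : g_sigma_algebraType A -> R[i]).
  by apply: L0_condexp => //; exact: L0_mulop.
pose psi x := truncated_inv C (e x).
have Lpsi : L0 (psi : g_sigma_algebraType A -> R[i]).
  exact: (@L0_truncated_inv _ _ (g_sigma_algebraType A) C e).
have Lh : Lp mu p (mulop psi f).
  have LpsiX := L0_subalgebra A A_sigma_algebra A_sub psi Lpsi.
  apply: (Lp_dominated _ _ p_ge1 C^-1 f) => //.
  - by rewrite invr_ge0 ltW.
  - by apply: L0_mulop => //; have [] := Lf.
  - by move=> x; rewrite modulusM ler_wpM2r ?modulus_ge0 ?normc_truncated_inv.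
exists (mulop psi f) => //.
have eC : {ae mu, forall x, C < modulus e x}.
  exists [set x | modulus e x <= C]; split => //.
    apply: (measurable_subalgebra _ A_sigma_algebra A_sub).
    rewrite -[X in measurable X]setTI.
    rewrite (_ : [set x | _] = [set x | ((EFin \o modulus e) x <= C%:E)%E]).
      apply: emeasurable_fun_infty_c => //.
      apply/measurable_EFinP; exact: measurable_modulus Le.
    by apply/seteqP; split => x /=; rewrite lee_fin.
  by move=> x /= /negP; rewrite -leNgt.
have Epsi := condexp_pull_out mu A A_sigma_algebra A_sub muA_sigma_finite
  mu_sigma_finite psi (mulop u f) Lpsi (uf_conditionable _ Lf).
apply: filterS3 (wce_wce _ Lh) eC Epsi => x -> Cx Ex _.
have Tpsi : T (mulop psi f) x = psi x * T f x.
  rewrite /wce /= 2!mulopE.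
  have -> : mulop u (mulop psi f) = mulop psi (mulop u f).
    by apply/funext => y; rewrite !mulopE; ring.
  by rewrite Ex mulrCA.
by rewrite Tpsi mulrA truncated_invK ?mul1r// ltW.
Qed.
End wce.

Theorem corollary2p7 (R : realType) (d : measure_display)
    (X : measurableType d) (mu : {measure set X -> \bar R})
    (mu_complete : measure_is_complete mu)
    (mu_sigma_finite : sigma_finite [set: X] mu)
    (A : set (set X)) (A_sigma_algebra : sigma_algebra [set: X] A)
    (A_sub : A `<=` measurable)
    (muA_sigma_finite : sigma_finite [set: g_sigma_algebraType A] mu)
    (p : \bar R) (p_ge1 : (1 <= p)%E)
    (u w : X -> R[i]) (u_L0 : L0 u) (w_L0 : L0 w)
    (uf_conditionable : forall f, Lp mu p f -> conditionable mu A (mulop u f))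
    (T_Lp : forall f, Lp mu p f -> Lp mu p (wce mu A w u f))
    (T_bounded : bounded_operator mu p (wce mu A w u)) :
  (ascent mu p (wce mu A w u) <= 2%:E)%E /\
  (bounded_away_from_zero mu (condexp mu A (mulop u w)) ->
   (descent mu p (wce mu A w u) <= 2%:E)%E).
Proof.
split.
  apply: le_least_index; apply: (null_space_iter2 _ _ _ T_Lp).
  exact: wce_wce.
move=> e_away; apply: (@le_trans _ _ 1%:R%:E); last by rewrite lee_fin ler_nat.
by apply: le_least_index; apply: range_space_iter1 => //; exact: wce_wce_onto.
Qed.
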